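(* Let $\alpha,\beta,\gamma\in\mathbb{R}$ with $\gamma\neq 0$, and let $(G_2,g,J)$ be the connected, simply connected three-dimensional Lorentzian Lie group with product structure $J$ whose Lie algebra $\mathfrak{g}$ has a pseudo-orthonormal basis $\{e_1,e_2,e_3\}$ ($e_3$ timelike) with $[e_1,e_2]=\gamma e_2-\beta e_3$, $[e_1,e_3]=-\beta e_2-\gamma e_3$, $[e_2,e_3]=\alpha e_1$. Let $c\in\mathbb{R}$. Then $(G_2,g,J)$ is a second kind algebraic Ricci soliton associated to the canonical connection $\nabla^0$ with constant $c$ if and only if $\alpha=\beta=0$, $\gamma^2+c=0$, $\gamma\neq 0$. In particular, in that case $\widetilde{\mathrm{Ric}}^0(e_1)=-\gamma^2e_1$, $\widetilde{\mathrm{Ric}}^0(e_2)=-\gamma^2e_2$, $\widetilde{\mathrm{Ric}}^0(e_3)=0$, and $De_1=0$, $De_2=0$, $De_3=\gamma^2e_3$.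
   Context: The left-invariant Lorentzian metric $g$ satisfies $g(e_1,e_1)=g(e_2,e_2)=1$, $g(e_3,e_3)=-1$, $g(e_i,e_j)=0$ for $i\ne j$. All tensors and connections are left-invariant and evaluated on $\mathfrak{g}$. $\nabla$ is the Levi-Civita connection of $g$. The product structure is $Je_1=e_1$, $Je_2=e_2$, $Je_3=-e_3$, and $(\nabla_XJ)Y=\nabla_X(JY)-J(\nabla_XY)$. The canonical connection is $\nabla^0_XY=\nabla_XY-\frac12(\nabla_XJ)(JY)$, with curvature $R^0(X,Y)Z=\nabla^0_X\nabla^0_YZ-\nabla^0_Y\nabla^0_XZ-\nabla^0_{[X,Y]}Z$. Its Ricci tensor is $\rho^0(X,Y)=-g(R^0(X,e_1)Y,e_1)-g(R^0(X,e_2)Y,e_2)+g(R^0(X,e_3)Y,e_3)$; its symmetrization is $\widetilde\rho^0(X,Y)=\frac12(\rho^0(X,Y)+\rho^0(Y,X))$, and the operator $\widetilde{\mathrm{Ric}}^0$ is defined by $\widetilde\rho^0(X,Y)=g(\widetilde{\mathrm{Ric}}^0(X),Y)$. Second kind algebraic Ricci soliton associated to $\nabla^0$ with constant $c$ means: $\widetilde{\mathrm{Ric}}^0=c\,\mathrm{Id}+D$ where $D$ is a derivation of $\mathfrak{g}$, i.e. a linear map with $D[X,Y]=[DX,Y]+[X,DY]$ for all $X,Y\in\mathfrak{g}$. *)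

(* Defs.v *)
From HB Require Import structures.
From mathcomp Require Import all_boot all_order all_algebra sesquilinear.
From mathcomp Require Import reals ring.

Set Implicit Arguments.
Unset Strict Implicit.
Unset Printing Implicit Defensive.

Import Order.TTheory GRing.Theory Num.Theory.
Local Open Scope ring_scope.

(* A left-invariant tensor or connection on a connected, simply connected Lie
   group is the corresponding multilinear map on its Lie algebra V.  In
   particular a left-invariant function is constant, so that its derivatives
   along left-invariant fields vanish, and nabla_X Y is bilinear in (X, Y). *)
Section LeftInvariantGeometry.

Variables (R : realType) (V : vectType R).
Variables (br : {bilinear V -> V -> V}) (g : {biscalar V}).
Implicit Types (X Y Z : V) (J D Ric : {linear V -> V}).

Definition lie_bracket : Prop :=
  (forall X, br X X = 0) /\
  (forall X Y Z, br X (br Y Z) + br Y (br Z X) + br Z (br X Y) = 0).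

Definition derivation D : Prop :=
  forall X Y, D (br X Y) = br (D X) Y + br X (D Y).

(* Pseudo-orthonormal basis with e3 timelike. *)
Definition pseudo_orthonormal_basis (e1 e2 e3 : V) : Prop :=
  [/\ basis_of fullv [:: e1; e2; e3],
      [/\ g e1 e1 = 1, g e2 e2 = 1 & g e3 e3 = -1],
      g e1 e2 = 0 /\ g e2 e1 = 0,
      g e1 e3 = 0 /\ g e3 e1 = 0
    & g e2 e3 = 0 /\ g e3 e2 = 0].

(* Torsion-free and metric; the terms X (g Y Z) vanish by left-invariance. *)
Definition levi_civita (nabla : {bilinear V -> V -> V}) : Prop :=
  (forall X Y, nabla X Y - nabla Y X = br X Y) /\
  (forall X Y Z, g (nabla X Y) Z + g Y (nabla X Z) = 0).

Definition cov_deriv_J (nabla : V -> V -> V) J X Y : V :=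
  nabla X (J Y) - J (nabla X Y).

Definition canonical_connection (nabla : V -> V -> V) J X Y : V :=
  nabla X Y - 2^-1 *: cov_deriv_J nabla J X (J Y).

Definition curvature (nab : V -> V -> V) X Y Z : V :=
  nab X (nab Y Z) - nab Y (nab X Z) - nab (br X Y) Z.

Definition ricci (nab : V -> V -> V) (e1 e2 e3 : V) X Y : R :=
  - g (curvature nab X e1 Y) e1 - g (curvature nab X e2 Y) e2
  + g (curvature nab X e3 Y) e3.

Definition sym_ricci (nab : V -> V -> V) (e1 e2 e3 : V) X Y : R :=
  2^-1 * (ricci nab e1 e2 e3 X Y + ricci nab e1 e2 e3 Y X).

Definition sym_ricci_operator (nab : V -> V -> V) (e1 e2 e3 : V) Ric : Prop :=
  forall X Y, sym_ricci nab e1 e2 e3 X Y = g (Ric X) Y.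

(* Ric is determined by sym_ricci_operator, because g is nondegenerate. *)
Definition second_kind_soliton_with (nab : V -> V -> V) (e1 e2 e3 : V) (c : R)
    Ric D : Prop :=
  [/\ sym_ricci_operator nab e1 e2 e3 Ric,
      derivation D
    & forall X, Ric X = c *: X + D X].

Definition second_kind_soliton (nab : V -> V -> V) (e1 e2 e3 : V) (c : R) :
    Prop :=
  exists Ric D, second_kind_soliton_with nab e1 e2 e3 c Ric D.

Definition G2_algebra (alpha beta gamma : R) (e1 e2 e3 : V) J : Prop :=
  [/\ lie_bracket,
      forall X Y, g X Y = g Y X,
      pseudo_orthonormal_basis e1 e2 e3,
      [/\ br e1 e2 = gamma *: e2 - beta *: e3,
          br e1 e3 = - (beta *: e2) - gamma *: e3
        & br e2 e3 = alpha *: e1]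
    & [/\ J e1 = e1, J e2 = e2 & J e3 = - e3]].

End LeftInvariantGeometry.

Section ExistenceOfLeviCivita.
Variables (R : realType) (V : vectType R).

Lemma pseudo_orthonormal_expand (g : {biscalar V}) (e1 e2 e3 : V) :
  pseudo_orthonormal_basis g e1 e2 e3 ->
  forall X, X = g X e1 *: e1 + g X e2 *: e2 - g X e3 *: e3.
Proof.
case=> hb [g11 g22 g33] [g12 g21] [g13 g31] [g23 g32] X.
have : X \in <<[:: e1; e2; e3]>>%VS by rewrite (span_basis hb) memvf.
rewrite !span_cons span_nil addv0.
case/memv_addP=> u /vlineP[a ->] [w /memv_addP[v /vlineP[b ->] [t /vlineP[d ->] ->]] ->].
rewrite !(linearDl, linearZl_LR) /= g11 g22 g33 g12 g21 g13 g31 g23 g32.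
by rewrite !mulr0 !mulr1 !addr0 !add0r mulrN1 scaleNr opprK addrA.
Qed.

Lemma levi_civita_exists (br : {bilinear V -> V -> V}) (g : {biscalar V})
    (e1 e2 e3 : V) :
  lie_bracket br -> (forall X Y, g X Y = g Y X) ->
  pseudo_orthonormal_basis g e1 e2 e3 ->
  exists nabla : {bilinear V -> V -> V}, levi_civita br g nabla.
Proof.
move=> [br0 _] gC he.
have brC X Y : br Y X = - br X Y.
  apply/eqP; rewrite -addr_eq0; apply/eqP.
  by have := br0 (X + Y); rewrite linearDl !linearDr !br0 add0r addr0 addrC.
pose k X Y Z := 2^-1 * (g (br X Y) Z - g (br Y Z) X + g (br Z X) Y).
pose n X Y := k X Y e1 *: e1 + k X Y e2 *: e2 - k X Y e3 *: e3.
have kDl Z a X X' Y : k (a *: X + X') Y Z = a * k X Y Z + k X' Y Z.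
  rewrite /k !(linearDl, linearDr, linearZl_LR, linearZr_LR) /=; ring.
have kDr Z a X Y Y' : k X (a *: Y + Y') Z = a * k X Y Z + k X Y' Z.
  rewrite /k !(linearDl, linearDr, linearZl_LR, linearZr_LR) /=; ring.
have kD3 a X Y Z Z' : k X Y (a *: Z + Z') = a * k X Y Z + k X Y Z'.
  rewrite /k !(linearDl, linearDr, linearZl_LR, linearZr_LR) /=; ring.
have nB : bilinear_for (GRing.Scale.Law.clone _ _ *:%R _)
     (GRing.Scale.Law.clone _ _ *:%R _) n.
  split=> u a x y; rewrite /n /= ?kDl ?kDr !scalerDl !scalerDr scalerN !scalerA;
  by rewrite opprD [RHS]addrACA; congr (_ + _); rewrite addrACA.
pose nb := HB.pack_for {bilinear V -> V -> V} n
  (bilinear_isBilinear.Build R V V V _ _ n nB).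
exists (nb : {bilinear V -> V -> V}).
have kn X Y Z : g (n X Y) Z = k X Y Z.
  have k0 : k X Y 0 = 0 by have := kD3 (-1) X Y 0 0; rewrite scaler0 addr0 mulN1r addNr.
  have kZ a W : k X Y (a *: W) = a * k X Y W by have := kD3 a X Y W 0; rewrite k0 !addr0.
  have kA W W' : k X Y (W + W') = k X Y W + k X Y W'.
    by have := kD3 1 X Y W W'; rewrite scale1r mul1r.
  rewrite [in RHS](pseudo_orthonormal_expand he Z) -scaleNr !kA !kZ.
  rewrite /n -scaleNr !(linearDl, linearZl_LR) /= !(gC _ Z); ring.
split=> [X Y|X Y Z] /=.
  rewrite (pseudo_orthonormal_expand he (br X Y)) /nb /= /n.
  have E Z : g (br X Y) Z = k X Y Z - k Y X Z.
    rewrite /k (brC X Y) (brC Y Z) (brC X Z) !linearNl /=.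
    by field.
  by rewrite !E !scalerBl !opprD [LHS]addrACA; congr (_ + _); rewrite addrACA.
rewrite /nb /= kn (gC Y) kn /k (brC X Y) (brC Y Z) (brC X Z) !linearNl /=; ring.
Qed.
End ExistenceOfLeviCivita.

(* G2_algebra has a model for all values of the parameters, on 'rV_3 with its
   standard basis. *)
Lemma G2_algebra_exists (R : realType) (alpha beta gamma : R) :
  exists (br : {bilinear 'rV[R]_3 -> 'rV[R]_3 -> 'rV[R]_3})
    (g : {biscalar 'rV[R]_3}) (J : {linear 'rV[R]_3 -> 'rV[R]_3}),
    G2_algebra br g alpha beta gamma 'e_(inord 0) 'e_(inord 1) 'e_(inord 2) J.
Proof.
pose i0 : 'I_3 := inord 0; pose i1 : 'I_3 := inord 1; pose i2 : 'I_3 := inord 2.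
have i01 : (i0 == i1) = false by rewrite -val_eqE /= !inordK.
have i02 : (i0 == i2) = false by rewrite -val_eqE /= !inordK.
have i12 : (i1 == i2) = false by rewrite -val_eqE /= !inordK.
have i10 : (i1 == i0) = false by rewrite eq_sym.
have i20 : (i2 == i0) = false by rewrite eq_sym.
have i21 : (i2 == i1) = false by rewrite eq_sym.
have iP (j : 'I_3) : [\/ j = i0, j = i1 | j = i2].
  case: j => [[|[|[|//]]] h]; [constructor 1|constructor 2|constructor 3];
  by apply/val_inj; rewrite /= inordK.
pose p (x y : 'rV[R]_3) i j := x 0 i * y 0 j - x 0 j * y 0 i.
pose b x y : 'rV[R]_3 := (alpha * p x y i1 i2) *: 'e_i0
  + (gamma * p x y i0 i1 - beta * p x y i0 i2) *: 'e_i1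
  + (- beta * p x y i0 i1 - gamma * p x y i0 i2) *: 'e_i2.
pose h (x y : 'rV[R]_3) : R := x 0 i0 * y 0 i0 + x 0 i1 * y 0 i1 - x 0 i2 * y 0 i2.
pose j (x : 'rV[R]_3) : 'rV[R]_3 := x - (2 * x 0 i2) *: 'e_i2.
have vP (x y : 'rV[R]_3) :
    x 0 i0 = y 0 i0 -> x 0 i1 = y 0 i1 -> x 0 i2 = y 0 i2 -> x = y.
  by move=> h0 h1 h2; apply/rowP=> k; case: (iP k) => ->.
have simp := (i01, i02, i10, i12, i20, i21, eqxx).
have bB : bilinear_for (GRing.Scale.Law.clone _ _ *:%R _)
     (GRing.Scale.Law.clone _ _ *:%R _) b.
  by split=> u a x y; apply: vP; rewrite /b /p !mxE ?simp /=; ring.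
have hB : bilinear_for (GRing.Scale.Law.clone _ _ *%R _)
     (GRing.Scale.Law.clone _ _ *%R _) h.
  by split=> u a x y; rewrite /h !mxE /=; ring.
have jL : linear j.
  by move=> a x y; apply: vP; rewrite /j !mxE ?simp /=; ring.
pose br := HB.pack_for {bilinear 'rV[R]_3 -> 'rV[R]_3 -> 'rV[R]_3} b
  (bilinear_isBilinear.Build R _ _ _ _ _ b bB).
pose g := HB.pack_for {biscalar 'rV[R]_3} h
  (bilinear_isBilinear.Build R _ _ _ _ _ h hB).
pose J := HB.pack_for {linear 'rV[R]_3 -> 'rV[R]_3} j
  (GRing.isLinear.Build R _ _ _ j jL).
exists br, g, J; split.
- split=> [X|X Y Z]; apply: vP; rewrite /= /b /p !mxE ?simp /=; ring.
- by move=> X Y; rewrite /= /h; ring.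
- split; rewrite -/i0 -/i1 -/i2 /= /h ?mxE ?simp /=.
  + rewrite basisEdim dimvf /= /dim /= leqnn andbT.
    apply/subvP=> x _.
    have -> : x = x 0 i0 *: 'e_i0 + x 0 i1 *: 'e_i1 + x 0 i2 *: 'e_i2.
      by apply: vP; rewrite !mxE ?simp /=; ring.
    by rewrite !rpredD ?rpredZ // memv_span // !inE eqxx ?orbT.
  + by split; rewrite ?mxE ?simp /=; ring.
  + by split; rewrite ?mxE ?simp /=; ring.
  + by split; rewrite ?mxE ?simp /=; ring.
  + by split; rewrite ?mxE ?simp /=; ring.
- by split; apply: vP; rewrite -/i0 -/i1 -/i2 /= /b /p !mxE ?simp /=; ring.
- by split; apply: vP; rewrite -/i0 -/i1 -/i2 /= /j !mxE ?simp /=; ring.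
Qed.

(* Main.v *)
(** Both [J] and the metric are compatible with the canonical connection
    [nabla0 = (nabla + J nabla J) / 2], so it kills [e3] and acts on the plane
    [<e1, e2>] through the abelian algebra so(2):
    [nabla0 X Y = omega X *: rot Y], where [rot] is the quarter turn of that
    plane and [omega X = g (nabla X e1) e2].  Hence its curvature is
    [- omega [X, Y] *: rot].  For G2, writing [xi = g X ei], the Koszul formula makes
    the symmetrized Ricci form
    [r (x1 y1 + x2 y2) - s (x2 y3 + x3 y2)] with [r = - (gamma^2 + alpha beta / 2)]
    and [s = gamma (2 beta - alpha) / 4].  The derivation condition on the basis
    amounts to [gamma (r - c) = - 2 beta s], [2 gamma s = beta (2 r - c) = - c beta]
    and [c alpha = 0].  Thus [beta r = 0]; if [beta != 0], then [r = 0] forces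
    [alpha != 0], so [c = s = 0], [alpha = 2 beta] and [gamma^2 + beta^2 = 0],
    which is absurd. *)
Require Import Defs.
From HB Require Import structures.
From mathcomp Require Import all_boot all_order all_algebra sesquilinear.
From mathcomp Require Import reals ring lra.

Set Implicit Arguments.
Unset Strict Implicit.
Unset Printing Implicit Defensive.

Import Order.TTheory GRing.Theory Num.Theory.
Local Open Scope ring_scope.

(** * The canonical connection and its Ricci form for an arbitrary bracket *)

Section LorentzianCanonicalConnection.

Variables (R : realType) (V : vectType R).
Variables (br : {bilinear V -> V -> V}) (g : {biscalar V}).
Variables (J : {linear V -> V}) (nabla : {bilinear V -> V -> V}).
Variables (e1 e2 e3 : V).
Hypothesis gC : forall X Y, g X Y = g Y X.
Hypothesis he : pseudo_orthonormal_basis g e1 e2 e3.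
Hypothesis nablaP : levi_civita br g nabla.

Lemma koszul X Y Z :
  2 * g (nabla X Y) Z = g (br X Y) Z - g (br Y Z) X + g (br Z X) Y.
Proof.
case: nablaP => torsion metric; rewrite -!torsion !linearBl /=.
have := metric X Y Z; have := metric Y X Z; have := metric Z X Y.
rewrite (gC Y) !(gC X); lra.
Qed.

Lemma eq_pseudo_orthonormal X Y :
  g X e1 = g Y e1 -> g X e2 = g Y e2 -> g X e3 = g Y e3 -> X = Y.
Proof.
move=> h1 h2 h3.
by rewrite (pseudo_orthonormal_expand he X) h1 h2 h3
  -(pseudo_orthonormal_expand he Y).
Qed.

Let rot Y := g Y e1 *: e2 - g Y e2 *: e1.
Let omega X := g (nabla X e1) e2.

Lemma canonical_connection_rot X Y :
  J e1 = e1 -> J e2 = e2 -> J e3 = - e3 ->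
  canonical_connection nabla J X Y = omega X *: rot Y.
Proof.
move=> J1 J2 J3; case: nablaP => _ metric.
case: (he) => _ [g11 g22 g33] [g12 g21] [g13 g31] [g23 g32].
have JE Z : J Z = g Z e1 *: e1 + g Z e2 *: e2 + g Z e3 *: e3.
  rewrite {1}(pseudo_orthonormal_expand he Z) linearB linearD !linearZ /=.
  by rewrite J1 J2 J3 !scalerN opprK.
(* The endomorphism [nabla X] is skew for [g], hence has three free entries. Averaging it with its
   conjugate by [J] removes the two that mix [e3] with the plane, and only [omega X] survives. *)
have skew Z W : g (nabla X Z) W = - g (nabla X W) Z.
  by apply/eqP; rewrite -addr_eq0 [X in _ + X]gC metric.
have skew0 Z : g (nabla X Z) Z = 0 by have := skew Z Z; lra.
rewrite /canonical_connection /cov_deriv_J.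
have JK : J (J Y) = Y.
  apply: eq_pseudo_orthonormal; rewrite !JE !(linearDl, linearZl_LR) /=
    ?g11 ?g22 ?g33 ?g12 ?g21 ?g13 ?g31 ?g23 ?g32; ring.
rewrite JK.
rewrite (JE Y) {1 2}(pseudo_orthonormal_expand he Y).
rewrite !(linearBr, linearDr, linearZr_LR) /=.
have := skew e2 e1; have := skew e3 e1; have := skew e3 e2.
have := skew0 e1; have := skew0 e2; have := skew0 e3.
move=> s3 s2 s1 s32 s31 s21.
apply: eq_pseudo_orthonormal;
  rewrite /omega /rot !JE
    !(linearBl, linearDl, linearZl_LR, linearNl) /=
    ?g11 ?g22 ?g33 ?g12 ?g21 ?g13 ?g31 ?g23 ?g32
    ?s1 ?s2 ?s3 ?s21 ?s31 ?s32; by field.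
Qed.

(** The terms quadratic in [omega] cancel because all values of the connection are multiples of the
    same [rot]. The [e3] term of the trace vanishes since [rot Y] lies in the plane. *)
Lemma ricci_canonical_connection X Y :
  J e1 = e1 -> J e2 = e2 -> J e3 = - e3 ->
  ricci br g (canonical_connection nabla J) e1 e2 e3 X Y =
  omega (br X e2) * g Y e1 - omega (br X e1) * g Y e2.
Proof.
move=> J1 J2 J3.
case: (he) => _ [g11 g22 g33] [g12 g21] [g13 g31] [g23 g32].
rewrite /ricci /curvature !canonical_connection_rot // /rot.
rewrite !(linearBl, linearDl, linearZl_LR, linearNl) /=.
rewrite ?g11 ?g22 ?g33 ?g12 ?g21 ?g13 ?g31 ?g23 ?g32; ring.
Qed.

End LorentzianCanonicalConnection.

(** * Ricci form and derivation equations of G2 *)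

Section G2.

Variables (R : realType) (V : vectType R) (alpha beta gamma : R).
Variables (br : {bilinear V -> V -> V}) (g : {biscalar V}).
Variables (J : {linear V -> V}) (nabla : {bilinear V -> V -> V}).
Variables (e1 e2 e3 : V).
Hypothesis hG2 : G2_algebra br g alpha beta gamma e1 e2 e3 J.
Hypothesis nablaP : levi_civita br g nabla.

Lemma G2_bracketC X Y : br Y X = - br X Y.
Proof.
case: hG2 => [[br0 _] _ _ _ _]; apply/eqP; rewrite -addr_eq0; apply/eqP.
by have := br0 (X + Y); rewrite linearDl !linearDr !br0 add0r addr0 addrC.
Qed.

(** Since [e3] is timelike, the coordinate of [X] along [e3] is [- g X e3]; this flips the signs of
    the last two terms. *)
Lemma G2_bracketE X Y :
  br X Y = (g X e1 * g Y e2 - g X e2 * g Y e1) *: (gamma *: e2 - beta *: e3)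
    + (g X e1 * g Y e3 - g X e3 * g Y e1) *: (beta *: e2 + gamma *: e3)
    - ((g X e2 * g Y e3 - g X e3 * g Y e2) * alpha) *: e1.
Proof.
case: (hG2) => [[br0 _] gC he [b12 b13 b23] _].
case: (he) => _ [g11 g22 g33] [g12 g21] [g13 g31] [g23 g32].
rewrite {1}(pseudo_orthonormal_expand he X) {1}(pseudo_orthonormal_expand he Y).
rewrite !(linearBl, linearDl, linearZl_LR, linearNl) /=.
rewrite !(linearBr, linearDr, linearZr_LR, linearNr) /=.
rewrite (G2_bracketC e1 e2) (G2_bracketC e1 e3) (G2_bracketC e2 e3).
rewrite !br0 b12 b13 b23.
apply: (eq_pseudo_orthonormal he);
  rewrite !(linearBl, linearDl, linearZl_LR, linearNl, linear0l) /=
    ?g11 ?g22 ?g33 ?g12 ?g21 ?g13 ?g31 ?g23 ?g32; ring.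
Qed.

Lemma G2_sym_ricci X Y :
  let r := - (gamma ^+ 2 + alpha * beta / 2) in
  let s := gamma * (2 * beta - alpha) / 4 in
  sym_ricci br g (canonical_connection nabla J) e1 e2 e3 X Y =
  r * (g X e1 * g Y e1 + g X e2 * g Y e2)
  - s * (g X e2 * g Y e3 + g X e3 * g Y e2).
Proof.
move=> r s; case: (hG2) => [_ gC he _ [J1 J2 J3]].
case: (he) => _ [g11 g22 g33] [g12 g21] [g13 g31] [g23 g32].
(* The two [beta] contributions to the Koszul formula cancel. *)
have omegaE Z : g (nabla Z e1) e2 = - gamma * g Z e2 - alpha / 2 * g Z e3.
  have := koszul gC nablaP Z e1 e2; rewrite !G2_bracketE.
  rewrite !(linearBl, linearDl, linearZl_LR, linearNl) /= !(gC _ Z).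
  rewrite ?g11 ?g22 ?g33 ?g12 ?g21 ?g13 ?g31 ?g23 ?g32; lra.
rewrite /sym_ricci !(ricci_canonical_connection gC he nablaP) // !omegaE.
rewrite !G2_bracketE !(linearBl, linearDl, linearZl_LR, linearNl) /=.
rewrite ?g11 ?g22 ?g33 ?g12 ?g21 ?g13 ?g31 ?g23 ?g32 /r /s; by field.
Qed.

Lemma G2_soliton_parameters c (Ric D : {linear V -> V}) :
  gamma != 0 ->
  second_kind_soliton_with br g (canonical_connection nabla J) e1 e2 e3 c Ric D ->
  [/\ alpha = 0, beta = 0 & c = - gamma ^+ 2].
Proof.
move=> gamma0 [RicP derD RicD].
case: (hG2) => [_ gC he [b12 b13 b23] _].
case: (he) => _ [g11 g22 g33] [g12 g21] [g13 g31] [g23 g32].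
have DP X Y : g (D X) Y = g (Ric X) Y - c * g X Y.
  by rewrite RicD linearDl linearZl_LR /=; ring.
have coord X Y Z := congr1 (fun W => g W Z) (derD X Y).
(* Four components of the derivation identity suffice. *)
have := coord e2 e3 e1; have := coord e1 e3 e2; have := coord e1 e2 e3.
have := coord e1 e2 e2; rewrite b12 b13 b23 => {coord}.
rewrite !(linearB, linearN, linearD, linearZ) /=.
rewrite !G2_bracketE.
rewrite !(linearBl, linearDl, linearZl_LR, linearNl) /=.
rewrite !DP -!RicP !G2_sym_ricci.
rewrite ?g11 ?g22 ?g33 ?g12 ?g21 ?g13 ?g31 ?g23 ?g32.
(* With [r] and [s] opaque, the relations below are linear in monomials such as [beta * r] and
   [gamma * s]. *)
move Er: (- (_ + _)) => r; move Es: (_ / 4) => s E1 E2 E3 E4.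
have {}E1 : gamma * (r - c) = - 2 * beta * s by lra.
have {}E2 : 2 * gamma * s = beta * (2 * r - c) by lra.
have {}E3 : 2 * gamma * s = - (c * beta) by lra.
have {}E4 : c * alpha = 0 by lra.
have br0 : beta * r = 0 by lra.
case: (eqVneq beta 0) => [b0|b0].
  (* For [beta = 0], [E3] gives [s = 0], whence [alpha = 0], and [E1] reduces to
     [c = r = - gamma ^+ 2]. *)
  have s0 : s = 0.
    move: E3; rewrite b0 mulr0 oppr0 => /eqP.
    by rewrite !mulf_eq0 (negPf gamma0) pnatr_eq0 => /eqP.
  have a0 : alpha = 0.
    move: s0; rewrite -Es b0 mulr0 sub0r => /eqP.
    by rewrite !mulf_eq0 (negPf gamma0) oppr_eq0 invr_eq0 pnatr_eq0 orbF => /eqP.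
  split=> //; move: E1; rewrite s0 mulr0 -Er a0 b0 => /eqP.
  by rewrite !mulf_eq0 (negPf gamma0) /= subr_eq0 mul0r mul0r addr0 => /eqP.
have r0 : r = 0 by move/eqP: br0; rewrite mulf_eq0 (negPf b0) => /eqP.
have g2 : 0 < gamma ^+ 2 by rewrite exprn_even_gt0.
have a0 : alpha != 0.
  by apply/eqP => a0; move: r0; rewrite -Er a0; lra.
have c0 : c = 0 by move/eqP: E4; rewrite mulf_eq0 (negPf a0) orbF => /eqP.
have ab : alpha = 2 * beta.
  move: E3; rewrite c0 mul0r oppr0 -Es => /eqP.
  by rewrite !mulf_eq0 (negPf gamma0) invr_eq0 !pnatr_eq0 /= orbF subr_eq0 => /eqP.
by move: r0; rewrite -Er ab; have := sqr_ge0 beta; nra.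
Qed.

End G2.

Theorem theorem2p17 (R : realType) (alpha beta gamma : R) (hgamma : gamma != 0)
    (V : vectType R) (br : {bilinear V -> V -> V}) (g : {biscalar V})
    (J : {linear V -> V}) (e1 e2 e3 : V)
    (hG2 : G2_algebra br g alpha beta gamma e1 e2 e3 J)
    (nabla : {bilinear V -> V -> V}) (hnabla : levi_civita br g nabla) (c : R) :
  let nabla0 := canonical_connection nabla J in
  (second_kind_soliton br g nabla0 e1 e2 e3 c <->
     [/\ alpha = 0 /\ beta = 0, gamma ^+ 2 + c = 0 & gamma != 0]) /\
  (forall Ric D : {linear V -> V},
     second_kind_soliton_with br g nabla0 e1 e2 e3 c Ric D ->
     [/\ Ric e1 = - (gamma ^+ 2 *: e1), Ric e2 = - (gamma ^+ 2 *: e2)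
       & Ric e3 = 0] /\
     [/\ D e1 = 0, D e2 = 0 & D e3 = gamma ^+ 2 *: e3]).
Proof.
move=> nabla0; case: (hG2) => [_ gC he [b12 b13 b23] _].
case: (he) => _ [g11 g22 g33] [g12 g21] [g13 g31] [g23 g32].
split; first split.
- case=> Ric [D sol].
  have [-> -> ->] := G2_soliton_parameters hG2 hnabla hgamma sol.
  by split=> //; rewrite subrr.
- case=> [[a0 b0] gc _].
  have {gc}cE : c = - gamma ^+ 2 by apply/eqP; rewrite -addr_eq0 addrC gc.
  (* Here [s = 0] and [r = c], so the Ricci operator must be [c] on the plane and [0] on [e3]. Thus
     [d] kills the plane and sends [e3] to [- c *: e3], the sign coming from [g e3 e3 = -1]. *)
  pose d (X : V) := (c * g X e3) *: e3; pose ric X := c *: X + d X.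
  have dL : linear d.
    move=> a X Y; rewrite /d linearDl linearZl_LR /= scalerA -scalerDl.
    by congr (_ *: _); ring.
  have ricL : linear ric.
    by move=> a X Y; rewrite /ric dL !scalerDr !scalerA (mulrC c) addrACA.
  pose D := HB.pack_for {linear V -> V} d (GRing.isLinear.Build R _ _ _ d dL).
  pose Ric := HB.pack_for {linear V -> V} ric
    (GRing.isLinear.Build R _ _ _ ric ricL).
  have DE Z : D Z = (c * g Z e3) *: e3 by [].
  have RicE Z : Ric Z = c *: Z + (c * g Z e3) *: e3 by [].
  exists Ric, D; split=> // X Y.
    have gE : g X Y = g X e1 * g Y e1 + g X e2 * g Y e2 - g X e3 * g Y e3.
      rewrite {1}(pseudo_orthonormal_expand he X).
      by rewrite !(linearBl, linearDl, linearZl_LR) /= !(gC _ Y).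
    rewrite (G2_sym_ricci hG2 hnabla) a0 b0 RicE linearDl !linearZl_LR /= gE.
    by rewrite (gC e3) cE; field.
  (* The only nonzero basis brackets are now multiples of [[e1, e2] = gamma e2] and [[e1, e3] = -
     gamma e3], so giving [e3] weight one and [e1], [e2] weight zero grades the algebra; [D] is
     [- c] times this grading. *)
  rewrite !DE !(G2_bracketE hG2) a0 b0.
  apply: (eq_pseudo_orthonormal he);
    rewrite !(linearBl, linearDl, linearZl_LR, linearNl) /=
      ?g11 ?g22 ?g33 ?g12 ?g21 ?g13 ?g31 ?g23 ?g32; ring.
move=> Ric D sol.
have [a0 b0 cE] := G2_soliton_parameters hG2 hnabla hgamma sol.
case: sol => [RicP _ RicD].
have RicE X Y : g (Ric X) Y = - gamma ^+ 2 * (g X e1 * g Y e1 + g X e2 * g Y e2).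
  by rewrite -RicP (G2_sym_ricci hG2 hnabla) a0 b0; field.
have [R1 R2 R3] : [/\ Ric e1 = - (gamma ^+ 2 *: e1),
    Ric e2 = - (gamma ^+ 2 *: e2) & Ric e3 = 0].
  split; apply: (eq_pseudo_orthonormal he);
  rewrite RicE ?linearNl ?linearZl_LR ?linear0l /=
      ?g11 ?g22 ?g33 ?g12 ?g21 ?g13 ?g31 ?g23 ?g32; ring.
have DE X : D X = Ric X - c *: X by rewrite RicD addrC addKr.
by split=> //; split; rewrite DE ?R1 ?R2 ?R3 cE scaleNr ?subrr // sub0r opprK.
Qed.
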